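(* Let $0<\alpha<1$, $\kappa>0$, $\epsilon>0$, and let $0=t_0<t_1<\cdots<t_N=T$ be an arbitrary time mesh with steps $\tau_n=t_n-t_{n-1}$. Suppose that $$\tau_n\le \frac{1}{\sqrt[\alpha]{\kappa\,\Gamma(2-\alpha)}}\qquad\text{for } 1\le n\le N .$$ Let $\phi^0,\phi^1,\dots,\phi^N\in\mathbb{V}_h$ be the solution of the L1 scheme $$\sum_{k=1}^{n}a_{n-k}^{(n)}\big(\phi_h^{k}-\phi_h^{k-1}\big)=-\kappa\mu_h^n,\qquad \mu_h^n:=(\phi_h^n)^3-\phi_h^n-\epsilon^2\Delta_h\phi_h^n,\qquad 1\le n\le N,$$ with initial data $\phi_h^0=\Phi_0(\mathbf{x}_h)$ and periodic boundary conditions. Then the scheme preserves the following discrete energy law at each time level: $$\partial_\tau\mathcal{E}_\alpha[\phi^n]:=\frac{\mathcal{E}_\alpha[\phi^n]-\mathcal{E}_\alpha[\phi^{n-1}]}{\tau_n}\le 0\qquad\text{for } 1\le n\le N,$$ where $\mathcal{E}_\alpha$ is the discrete variational energy $$\mathcal{E}_\alpha[\phi^0]:=E[\phi^0],\qquad \mathcal{E}_\alpha[\phi^n]:=E[\phi^n]+\frac{\kappa}{2}\sum_{j=1}^{n}p_{n-j}^{(n)}\|\mu^j\|^2\quad\text{for } n\ge1,$$ $$E[\phi^n]:=\frac{\epsilon^2}{2}\|\nabla_h\phi^n\|^2+\frac14\big\|(\phi^n)^2-1\big\|^2\quad\text{for } n\ge0 .$$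
   Context: Spatial grid: $\Omega=(0,L)^2$, $h=L/M$ for an integer $M$, grid points $\mathbf{x}_h=(ih,jh)$, $\Omega_h$ is the set of grid points of one period ($1\le i,j\le M$), and $\mathbb{V}_h$ is the space of real grid functions $v=(v_h)$ that are $L$-periodic in each coordinate direction. The discrete inner product is $\langle v,w\rangle:=h^2\sum_{\mathbf{x}_h\in\Omega_h}v_hw_h$ and $\|v\|:=\sqrt{\langle v,v\rangle}$. $\Delta_h$ is the standard second-order central (five-point) difference Laplacian and $\nabla_h$ the corresponding discrete gradient, so that the discrete Green formula $\langle-\Delta_hv,w\rangle=\langle\nabla_hv,\nabla_hw\rangle$ holds on $\mathbb{V}_h$. Powers of grid functions are pointwise. $\Phi_0$ is a given $L$-periodic initial function. L1 kernels: with $\omega_\beta(t):=t^{\beta-1}/\Gamma(\beta)$, $$a_{n-k}^{(n)}:=\frac{1}{\tau_k}\int_{t_{k-1}}^{t_k}\omega_{1-\alpha}(t_n-s)\,\mathrm{d}s,\qquad 1\le k\le n.$$ Discrete orthogonal convolution (DOC) kernels $\theta_{n-k}^{(n)}$ are defined recursively by $$\theta_0^{(n)}:=\frac{1}{a_0^{(n)}},\qquad \theta_{n-k}^{(n)}:=-\frac{1}{a_0^{(k)}}\sum_{j=k+1}^{n}\theta_{n-j}^{(n)}a_{j-k}^{(j)}\quad\text{for }1\le k\le n-1 .$$ Discrete complementary convolution (DCC) kernels are $p_{n-k}^{(n)}:=\sum_{j=k}^{n}\theta_{j-k}^{(j)}$ for $1\le k\le n$. *)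

(* Defs.v *)
From HB Require Import structures.
From mathcomp Require Import all_boot all_order all_algebra.
From mathcomp Require Import all_classical all_reals all_analysis.
From mathcomp Require Import ring.

Set Implicit Arguments.
Unset Strict Implicit.
Unset Printing Implicit Defensive.

Import Order.TTheory GRing.Theory Num.Theory.
Import numFieldNormedType.Exports.

Local Open Scope classical_set_scope.
Local Open Scope ring_scope.

(* The value [v i j] of a grid function is its value at the grid point
   (i h, j h).  All integer indices are allowed: the space V_h is cut out by
   [grid_periodic], whose period of M indices is the length L = M h. *)
Definition gridfun (R : realType) := int -> int -> R.

Section Grid.
Context {R : realType}.
Implicit Types (M : nat) (h : R) (v w : gridfun R).

Definition grid_periodic M v :=
  forall i j : int, v (i + M%:Z) j = v i j /\ v i (j + M%:Z) = v i j.

Definition inner M h v w : R :=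
  h ^+ 2 * \sum_(1 <= i < M.+1) \sum_(1 <= j < M.+1) v i%:Z j%:Z * w i%:Z j%:Z.

Definition norm2 M h v : R := Num.sqrt (inner M h v v).

Definition laplacian h v : gridfun R := fun i j =>
  (v (i + 1) j + v (i - 1) j + v i (j + 1) + v i (j - 1) - 4%:R * v i j)
  / h ^+ 2.

(* Forward differences, the choice for which [green] below holds with the
   five-point Laplacian. *)
Definition gradient h v : gridfun R * gridfun R :=
  (fun i j => (v (i + 1) j - v i j) / h, fun i j => (v i (j + 1) - v i j) / h).

Definition vinner M h (V W : gridfun R * gridfun R) : R :=
  inner M h V.1 W.1 + inner M h V.2 W.2.

Definition vnorm2 M h (V : gridfun R * gridfun R) : R :=
  Num.sqrt (vinner M h V V).

Definition chem_pot h (eps : R) v : gridfun R := fun i j =>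
  v i j ^+ 3 - v i j - eps ^+ 2 * laplacian h v i j.

Definition energy M h (eps : R) v : R :=
  eps ^+ 2 / 2%:R * vnorm2 M h (gradient h v) ^+ 2
  + 1 / 4%:R * norm2 M h (fun i j => v i j ^+ 2 - 1) ^+ 2.

End Grid.

Section Kernels.
Context {R : realType}.
Variables (alpha : R) (t : nat -> R).

Definition Gamma (b : R) : R :=
  \int[lebesgue_measure]_(x in `]0, +oo[) (x `^ (b - 1) * expR (- x)).

Definition omega (b x : R) : R := x `^ (b - 1) / Gamma b.

Definition step (n : nat) : R := t n - t n.-1.

(* Every kernel X is indexed by (n, k): [X n k] is X^(n)_(n-k). *)

(* For k = n the integrand is singular at s = t n; the value taken by
   [omega] there is irrelevant, a single point being Lebesgue-null. *)
Definition l1_kernel (n k : nat) : R :=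
  (step k)^-1 *
  \int[lebesgue_measure]_(s in `[t k.-1, t k]) omega (1 - alpha) (t n - s).

(* The list [:: theta^(n)_0; ...; theta^(n)_m]; the recursion of the DOC
   kernels runs over m = n - k, i.e. over decreasing k. *)
Fixpoint doc_seq (n m : nat) : seq R :=
  if m is m'.+1 then
    let s := doc_seq n m' in
    let k := (n - m)%N in
    rcons s (- (l1_kernel k k)^-1 *
             \sum_(k.+1 <= j < n.+1) nth 0 s (n - j) * l1_kernel j k)
  else [:: 1 / l1_kernel n n].

Definition doc_kernel (n k : nat) : R := nth 0 (doc_seq n (n - k)) (n - k).

Definition dcc_kernel (n k : nat) : R := \sum_(k <= j < n.+1) doc_kernel j k.

Definition var_energy (M : nat) (h eps kappa : R) (phi : nat -> gridfun R)
    (n : nat) : R :=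
  if n is 0 then energy M h eps (phi 0%N)
  else energy M h eps (phi n)
       + kappa / 2%:R * \sum_(1 <= j < n.+1)
           dcc_kernel n j * norm2 M h (chem_pot h eps (phi j)) ^+ 2.

Definition diff_quot (u : nat -> R) (n : nat) : R := (u n - u n.-1) / step n.

Lemma size_doc_seq n m : size (doc_seq n m) = m.+1.
Proof. by elim: m => //= m IH; rewrite size_rcons IH. Qed.

Lemma nth_doc_seq n m l : (l <= m)%N ->
  nth 0 (doc_seq n m) l = nth 0 (doc_seq n l) l.
Proof.
elim: m => [|m IH]; first by rewrite leqn0 => /eqP ->.
rewrite leq_eqVlt => /predU1P[-> //|lm].
by rewrite /= nth_rcons size_doc_seq lm IH.
Qed.

Lemma doc_kernel_diag n : doc_kernel n n = 1 / l1_kernel n n.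
Proof. by rewrite /doc_kernel subnn. Qed.

Lemma doc_kernel_rec n k : (1 <= k <= n.-1)%N ->
  doc_kernel n k =
  - (l1_kernel k k)^-1 *
  \sum_(k.+1 <= j < n.+1) doc_kernel n j * l1_kernel j k.
Proof.
move=> /andP[k0 kn].
have ltkn : (k < n)%N by case: n kn => [|n] /=; [case: k k0|].
rewrite /doc_kernel; have [m nkE] : exists m, (n - k)%N = m.+1.
  by exists (n - k).-1; rewrite prednK// subn_gt0.
rewrite nkE /= nth_rcons size_doc_seq ltnn eqxx -nkE subKn ?(ltnW ltkn)//.
congr (_ * _); apply: eq_big_nat => j /andP[kj jn].
by rewrite nth_doc_seq// -ltnS -nkE ltn_sub2l.
Qed.

End Kernels.

Section Green.
Context {R : realType}.
Implicit Types (M : nat) (h : R) (v w : gridfun R).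

Lemma sum_shift M (f : int -> R) : (forall i : int, f (i + M%:Z) = f i) ->
  \sum_(1 <= i < M.+1) f (i%:Z - 1) = \sum_(1 <= i < M.+1) f i%:Z.
Proof.
move=> fM; rewrite big_add1 /=.
under eq_bigr do rewrite -addn1 PoszD addrK.
case: M fM => [|M] fM; first by rewrite !big_geq.
rewrite big_nat_recl// [RHS]big_nat_recr//= addrC; congr (_ + _).
  by rewrite -(fM 0) add0r.
by rewrite [RHS]big_add1.
Qed.

Lemma green1 M h (f g : int -> R) :
  (forall i : int, f (i + M%:Z) = f i) -> (forall i : int, g (i + M%:Z) = g i) ->
  \sum_(1 <= i < M.+1)
    - ((f (i%:Z + 1) + f (i%:Z - 1) - 2%:R * f i%:Z) / h ^+ 2) * g i%:Z =
  \sum_(1 <= i < M.+1)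
    (f (i%:Z + 1) - f i%:Z) / h * ((g (i%:Z + 1) - g i%:Z) / h).
Proof.
move=> fM gM.
pose F (i : int) := (f (i + 1) - f i) / h ^+ 2 * g (i + 1).
have FM i : F (i + M%:Z) = F i.
  by rewrite /F -!(addrAC i 1) !fM gM.
apply/eqP; rewrite -subr_eq0 -sumrB.
rewrite (eq_bigr (fun i : nat => F (i%:Z - 1) - F i%:Z)); last first.
  move=> i _; rewrite /F subrK expr2 invfM; move: (h^-1) => k; ring.
by rewrite sumrB sum_shift// subrr.
Qed.

Lemma green M h v w : grid_periodic M v -> grid_periodic M w ->
  inner M h (fun i j => - laplacian h v i j) w =
  vinner M h (gradient h v) (gradient h w).
Proof.
move=> vM wM; rewrite /vinner /inner -mulrDr; congr (_ * _).
rewrite [X in _ = X + _]exchange_big /=.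
have g1 (j : int) := @green1 M h (v^~ j) (w^~ j)
  (fun i => (vM i j).1) (fun i => (wM i j).1).
have g2 (i : int) := @green1 M h (v i) (w i)
  (fun j => (vM i j).2) (fun j => (wM i j).2).
under [X in _ = X + _]eq_bigr do rewrite -g1.
under [X in _ = _ + X]eq_bigr do rewrite -g2.
rewrite [X in _ = X + _]exchange_big /= -big_split /=.
apply: eq_bigr => i _; rewrite -big_split /=; apply: eq_bigr => j _.
rewrite /laplacian; move: (h ^+ 2)^-1 => k; ring.
Qed.

End Green.

(* Main.v *)
Require Import Defs.
From HB Require Import structures.
From mathcomp Require Import all_boot all_order all_algebra.
From mathcomp Require Import all_classical all_reals all_analysis.
From mathcomp Require Import measurable_realfun ring lra.

Set Implicit Arguments.
Unset Strict Implicit.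
Unset Printing Implicit Defensive.

Import Order.TTheory GRing.Theory Num.Theory.
Import numFieldNormedType.Exports.

Local Open Scope classical_set_scope.
Local Open Scope ring_scope.

(** The DOC kernels invert the lower triangular matrix of L1 kernels, so the
scheme reads phi^n - phi^(n-1) = - kappa sum_j theta^(n)_(n-j) mu^j.  Since
s |-> (t_n - s)^(-alpha) decreases in t_n and the ratio
((t_j - s) / (t_n - s))^alpha decreases in s, the matrix of DOC kernels has
nonpositive off-diagonal entries and nonnegative row sums.  On the other hand
the energy increment is at most <mu^n, phi^n - phi^(n-1)> +
|phi^n - phi^(n-1)|^2 / 2, by convexity of u^4/4 and of the gradient term, and
the memory term increases by (kappa / 2) sum_j theta^(n)_(n-j) |mu^j|^2.  At
every grid point the sum of these contributions is a quadratic form in the mu^j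
which is nonpositive as soon as kappa <= a^(n)_0 =
tau_n^(-alpha) / Gamma (2 - alpha), and this is the step size condition. *)

(** * Singular integrals and the Gamma function *)

Lemma integral_is_derive (R : realType) (f F : R -> R) (a b : R) :
  a < b ->
  (forall x, a <= x <= b -> is_derive x 1 F (f x)) ->
  (forall x, a <= x <= b -> {for x, continuous f}) ->
  (\int[lebesgue_measure]_(x in `[a, b]) (f x)%:E = (F b - F a)%:E)%E.
Proof.
move=> ab dF cf.
have cF x : a <= x <= b -> {for x, continuous F}.
  move=> /dF dFx; apply: differentiable_continuous.
  by apply/derivable1_diffP; exact: ex_derive.
rewrite EFinB; apply: continuous_FTC2 => //.
- apply: continuous_in_subspaceT => x; rewrite inE/= in_itv/=; exact: cf.
- split.
  + move=> x; rewrite in_itv/= => /andP[ax xb].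
    by apply: @ex_derive; apply: dF; rewrite !ltW.
  + by apply: cvg_at_right_filter; apply: cF; rewrite lexx ltW.
  + by apply: cvg_at_left_filter; apply: cF; rewrite lexx ltW.
- move=> x; rewrite in_itv/= => /andP[ax xb].
  by rewrite derive1E; apply: derive_val; apply: dF; rewrite !ltW.
Qed.

Lemma continuous_powR (R : realType) (p x : R) :
  0 < x -> {for x, continuous (@powR R ^~ p)}.
Proof.
move=> x0; apply: differentiable_continuous; apply/derivable1_diffP.
by apply: derivable_powR; rewrite in_itv/= x0.
Qed.

(** * Integral of a power with an endpoint singularity *)

Section singular_integral.
Variables (R : realType) (p a c : R).
Hypotheses (p0 : 0 < p) (ac : a < c).
Notation mu := (@lebesgue_measure R).

(** These intervals stop short of the singularity at c. The denominator is n + 2 because n + 1 would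
    make the first one a single point, while [integral_is_derive] asks for distinct endpoints. *)
Let itv_exhaust n := `[a, c - (c - a) / n.+2%:R]%classic.

Let bigcup_itv_exhaust : \bigcup_n itv_exhaust n = `[a, c[%classic.
Proof.
apply/seteqP; split => [x [n _]|x]; rewrite /itv_exhaust /= !in_itv/=.
  move=> /andP[-> /le_lt_trans]; apply.
  by rewrite ltrBlDr ltrDl divr_gt0// subr_gt0.
move=> /andP[ax xc].
have xc0 : 0 < c - x by rewrite subr_gt0.
(* Any n with (c - a) / (c - x) <= n + 2 puts x in the n-th interval. *)
exists (Num.truncn ((c - a) / (c - x))) => //=.
rewrite /itv_exhaust /= in_itv/= ax/= lerBrDr -lerBrDl.
rewrite ler_pdivrMr// mulrC -ler_pdivrMr//.
apply: ltW; apply: lt_trans (truncnS_gt _) _.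
by rewrite ltr_nat.
Qed.

Let measurable_integrand (A : set R) :
  measurable_fun A (fun s : R => (c - s) `^ (p - 1)).
Proof.
apply: measurable_funTS.
apply: (measurableT_comp (measurable_powR (p - 1))).
exact: measurable_funB.
Qed.

Let integral_exhaust n :
  (\int[mu]_(s in itv_exhaust n) ((c - s) `^ (p - 1))%:E =
   ((c - a) `^ p / p - ((c - a) / n.+2%:R) `^ p / p)%:E)%E.
Proof.
have ca : 0 < c - a by rewrite subr_gt0.
have cn : 0 < (c - a) / n.+2%:R by rewrite divr_gt0.
transitivity ((- ((c - (c - (c - a) / n.+2%:R)) `^ p / p) -
  - ((c - a) `^ p / p))%:E); last by rewrite opprK addrC subKr.
apply: (@integral_is_derive R (fun s => (c - s) `^ (p - 1))
  (fun s => - ((c - s) `^ p / p))).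
- rewrite ltrBrDl -ltrBrDr ltr_pdivrMr// ltr_pMr//.
  by rewrite (_ : 1 = 1%:R)// ltr_nat.
- move=> x /andP[ax xb].
  have cx : 0 < c - x by rewrite subr_gt0 (le_lt_trans xb)// gtrBl.
  have D : is_derive x 1 (fun s : R => (c - s) `^ p)
      (p * (c - x) `^ (p - 1) * (- 1)).
    have D1 : is_derive x 1 (fun s : R => c - s) (- 1).
      by apply: is_derive_eq; rewrite add0r mul1r.
    exact: (@is_derive1_comp _ (@powR R ^~ p) (fun s : R => c - s) _ _ _
      (is_derive1_powR p cx) D1).
  have -> : (c - x) `^ (p - 1) =
      - (p * (c - x) `^ (p - 1) * (- 1) * p^-1).
    by rewrite mulrN1 mulNr opprK mulrAC divff ?mul1r// gt_eqF.
  apply: is_deriveN.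
  under eq_fun do rewrite mulrC.
  by rewrite mulrC; exact: is_deriveZ.
- move=> x /andP[ax xb].
  have cx : 0 < c - x by rewrite subr_gt0 (le_lt_trans xb)// gtrBl.
  have C1 : {for x, continuous (fun s : R => c - s)}.
    by apply: cvgB; [exact: cvg_cst|exact: cvg_id].
  apply: (@continuous_comp _ _ _ _ (@powR R ^~ (p - 1)) _ C1).
  exact: continuous_powR.
Qed.

(** Monotone convergence along [itv_exhaust]: the antiderivative is - (c - s)^p / p, and its value
    at the moving endpoint tends to 0 because p > 0. *)
Lemma integral_singular_powR :
  (\int[mu]_(s in `[a, c[) ((c - s) `^ (p - 1))%:E = ((c - a) `^ p / p)%:E)%E.
Proof.
have ca : 0 < c - a by rewrite subr_gt0.
have nd : {homo itv_exhaust : m n / (m <= n)%N >-> (m <= n)%O}.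
  move=> m n mn; apply/subsetPset => x; rewrite /itv_exhaust/= !in_itv/=.
  move=> /andP[-> /le_trans]; apply.
  by rewrite lerD2l lerN2 ler_pM2l// lef_pV2 ?posrE// ler_nat.
have cvgi : (\int[mu]_(s in itv_exhaust n) ((c - s) `^ (p - 1))%:E @[n --> \oo]
    --> \int[mu]_(s in \bigcup_n itv_exhaust n) ((c - s) `^ (p - 1))%:E)%E.
  apply: ge0_nondecreasing_set_cvg_integral => //.
  - by move=> n; exact: measurable_itv.
  - by move=> n; apply/measurable_EFinP; exact: measurable_integrand.
  - by move=> *; rewrite lee_fin powR_ge0.
rewrite bigcup_itv_exhaust in cvgi.
rewrite (eq_cvg _ _ integral_exhaust) in cvgi.
apply/esym; apply: (cvg_unique _ _ cvgi) => //.
apply: cvg_EFin; first exact: nearW.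
rewrite -[X in _ --> X]subr0; apply: cvgB; first exact: cvg_cst.
rewrite -(mul0r p^-1); apply: cvgMr_tmp.
have /cvg_at_rightP := powR_cvg0 p0; apply; split.
  by move=> n; rewrite divr_gt0.
rewrite -(mulr0 (c - a)); apply: cvgMl_tmp.
by have := @cvg_harmonic R; rewrite -cvg_shiftS; exact.
Qed.

Lemma integrable_singular_powR :
  mu.-integrable `[a, c[ (EFin \o (fun s => (c - s) `^ (p - 1))).
Proof.
apply/integrableP; split.
  apply/measurable_EFinP; exact: measurable_integrand.
under eq_integral do rewrite /= ger0_norm ?powR_ge0//.
by rewrite integral_singular_powR ltry.
Qed.

End singular_integral.

Lemma integrable_EFinZr d (T : measurableType d) (R : realType)
    (mu : {measure set T -> \bar R}) (D : set T) (c : R) (f : T -> R) :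
  measurable D -> mu.-integrable D (EFin \o f) ->
  mu.-integrable D (EFin \o (fun x => f x * c)).
Proof.
move=> mD intf; rewrite (_ : _ \o _ = (fun x => (EFin \o f) x * c%:E)%E)//.
exact: integrableZr.
Qed.

(** * The Gamma function on (0, 1): recurrence, finiteness, positivity *)

Section gamma.
Variables (R : realType) (b : R).
Hypotheses (b0 : 0 < b) (b1 : b < 1).
Notation mu := (@lebesgue_measure R).

Let f (q : R) : R -> R := fun x => x `^ (q - 1) * expR (- x).

Let f_ge0 q x : 0 <= f q x.
Proof. by rewrite mulr_ge0 ?powR_ge0 ?expR_ge0. Qed.

Let measurable_f q (A : set R) : measurable_fun A (f q).
Proof.
apply: measurable_funTS; apply: measurable_funM => //.
by apply: measurableT_comp => //; exact: measurable_oppr.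
Qed.

Let f1b x : 0 <= x -> f (1 + b) x = x `^ b * expR (- x).
Proof. by move=> x0; rewrite /f addrC addKr. Qed.

(** From x^b <= 1 + x <= 2 exp(x / 2). The bound serves twice: to dominate the integral for 1 + b,
    and to kill the boundary term at infinity. *)
Let xb_le x : 0 <= x -> x `^ b * expR (- x) <= 2 * expR (- x / 2).
Proof.
move=> x0.
have xb : x `^ b <= 1 + x.
  have [x1|/ltW x1] := leP x 1.
    have : x `^ b <= 1 `^ b by apply: ge0_ler_powR; rewrite ?nnegrE// ltW.
    by rewrite powR1 => /le_trans; apply; rewrite lerDl.
  by rewrite (le_trans (ler1_powR x1 (ltW b1)))// lerDr.
have ex : 1 + x / 2 <= expR (x / 2) by apply: expR_ge1Dx.
have e : expR (- x) = expR (- x / 2) * expR (- x / 2).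
  by rewrite -expRD; congr expR; lra.
have ee : expR (x / 2) * expR (- x / 2) = 1.
  by rewrite -expRD -[RHS]expR0; congr expR; lra.
have E0 := expR_gt0 (- x / 2).
rewrite e mulrA.
apply: (@le_trans _ _ (2 * expR (x / 2) * expR (- x / 2) * expR (- x / 2))).
  by rewrite !ler_pM2r//; apply: (le_trans xb); lra.
by rewrite -(mulrA 2) ee mulr1.
Qed.

Let K n := `[n.+2%:R^-1 : R, n.+2%:R]%classic.

Let bigcup_K : \bigcup_n K n = `]0, +oo[%classic.
Proof.
apply/seteqP; split => [x [n _]|x]; rewrite /K /= !in_itv/= ?andbT.
  by move=> /andP[+ _]; apply: lt_le_trans; rewrite invr_gt0.
move=> x0.
exists (Num.truncn (Num.max x x^-1)) => //=.
have : Num.max x x^-1 <= (Num.truncn (Num.max x x^-1)).+2%:R.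
  by apply: ltW; apply: lt_trans (truncnS_gt _) _; rewrite ltr_nat.
set m := _.+2; rewrite ge_max => /andP[xm xVm].
by rewrite in_itv/= xm andbT -[x]invrK lef_pV2 ?posrE// ?invr_gt0.
Qed.

Let cvg_K q : (\int[mu]_(x in K n) (f q x)%:E @[n --> \oo] -->
  \int[mu]_(x in `]0%R, +oo[) (f q x)%:E)%E.
Proof.
rewrite -bigcup_K; apply: ge0_nondecreasing_set_cvg_integral => //.
- move=> m n mn; apply/subsetPset => x; rewrite /K/= !in_itv/=.
  move=> /andP[mx xm]; apply/andP; split.
    by apply: le_trans mx; rewrite lef_pV2 ?posrE// ler_nat.
  by rewrite (le_trans xm)// ler_nat.
- by move=> n; exact: measurable_itv.
- by move=> n; apply/measurable_EFinP; exact: measurable_f.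
- by move=> *; rewrite lee_fin.
Qed.

Let continuous_f q x : 0 < x -> {for x, continuous (f q)}.
Proof.
move=> x0; apply: cvgM; first exact: continuous_powR.
by apply: continuous_comp; [exact: opp_continuous|exact: continuous_expR].
Qed.

Let integrable_K q n : mu.-integrable (K n) (EFin \o f q).
Proof.
apply: continuous_compact_integrable; first exact: segment_compact.
apply: continuous_in_subspaceT => x; rewrite inE /K/= in_itv/= => /andP[x0 _].
have {}x0 : 0 < x by apply: lt_le_trans x0; rewrite invr_gt0.
exact: continuous_f.
Qed.

Let F x := x `^ b * expR (- x).

(** Integration by parts away from 0 and infinity: [F] is an antiderivative of b f_b - f_(1+b). *)
Let integral_K n : (b%:E * \int[mu]_(x in K n) (f b x)%:E =
  \int[mu]_(x in K n) (f (1 + b) x)%:E + (F n.+2%:R - F n.+2%:R^-1)%:E)%E.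
Proof.
have n2 : 0 < n.+2%:R^-1 :> R by rewrite invr_gt0.
have iK : (\int[mu]_(x in K n) (b * f b x - f (1 + b) x)%:E =
    (F n.+2%:R - F n.+2%:R^-1)%:E)%E.
  apply: integral_is_derive.
  - by rewrite (@lt_trans _ _ 1)// ?invf_lt1// (_ : 1 = 1%:R)// ltr_nat.
  - move=> x /andP[xn _].
    have x0 : 0 < x by exact: lt_le_trans xn.
    have D1 : is_derive x 1 (fun x : R => expR (- x)) (expR (- x) * (- 1)).
      exact: is_derive1_comp.
    have DF := is_deriveM (is_derive1_powR b x0) D1.
    rewrite (_ : b * f b x - _ = x `^ b *: (expR (- x) * -1) +
        expR (- x) *: (b * x `^ (b - 1))); first exact: DF.
    rewrite f1b ?ltW// /f /GRing.scale/=; ring.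
  - move=> x /andP[xn _].
    have x0 : 0 < x by exact: lt_le_trans xn.
    by apply: cvgB; [apply: cvgMl_tmp|]; exact: continuous_f.
have mK : measurable (K n : set (measurableTypeR R)) by exact: measurable_itv.
have iK1 := integrable_K (1 + b) n; have iKb := integrable_K b n.
rewrite -iK.
have i1 : mu.-integrable (K n) (EFin \o (fun x => b * f b x)).
  rewrite (_ : _ \o _ = (fun x => b%:E * (EFin \o f b) x)%E)//.
  by apply: integrableZl; [exact: measurable_itv|exact: integrable_K].
rewrite integralB_EFin//.
under [in RHS]eq_integral do rewrite EFinM.
by rewrite integralZl// addeC subeK//; exact: (integrable_fin_num mK iK1).
Qed.

Let cvg_F : F n.+2%:R - F n.+2%:R^-1 @[n --> \oo] --> (0 : R).
Proof.
rewrite -[X in _ --> X](subr0 (0 : R)); apply: cvgB.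
  apply: (@squeeze_cvgr _ _ _ _ (fun=> 0) (fun n => 2 * expR (- n.+2%:R / 2))).
  - by apply: nearW => n; rewrite /F mulr_ge0 ?powR_ge0 ?expR_ge0//= xb_le.
  - exact: cvg_cst.
  - rewrite -(mulr0 2); apply: cvgMl_tmp.
    have h1 : (n.+2%:R : R) @[n --> \oo] --> +oo.
      by have := @cvgr_idn R; rewrite -2!cvg_shiftS; exact.
    have i2 : 0 < 2^-1 :> R by rewrite invr_gt0.
    have h2 : (r * 2^-1 : R) @[r --> +oo] --> +oo.
      exact: gt0_cvgMly i2 (@cvg_id _ _).
    have := cvg_comp _ _ h1 (cvg_comp _ _ h2 (@cvgr_expR R)).
    apply: cvg_trans; apply: near_eq_cvg; apply: nearW => n.
    by rewrite /= mulNr.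
rewrite -[X in _ --> X](mulr0 (0 : R)).
apply: (@squeeze_cvgr _ _ _ _ (fun=> 0) (fun n => n.+2%:R^-1 `^ b)).
- apply: nearW => n; rewrite /F mulr_ge0 ?powR_ge0 ?expR_ge0//=.
  have : expR (- n.+2%:R^-1) <= expR 0 :> R.
    by rewrite ler_expR oppr_le0 invr_ge0.
  by rewrite expR0 => ?; rewrite ler_piMr ?powR_ge0.
- by rewrite mulr0; exact: cvg_cst.
- rewrite mulr0; have /cvg_at_rightP := powR_cvg0 b0; apply; split.
    by move=> n; rewrite invr_gt0.
  by have := @cvg_harmonic R; rewrite -cvg_shiftS; exact.
Qed.

(** The recurrence is stated in the extended reals, before either integral is known to be finite;
    the boundary terms are finite, so the limit of the sum is well defined. *)
Let gamma_rec : (b%:E * \int[mu]_(x in `]0%R, +oo[) (f b x)%:E =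
  \int[mu]_(x in `]0%R, +oo[) (f (1 + b) x)%:E)%E.
Proof.
have cb : (b%:E * \int[mu]_(x in K n) (f b x)%:E @[n --> \oo] -->
    b%:E * \int[mu]_(x in `]0%R, +oo[) (f b x)%:E)%E.
  exact: cvgeZl.
rewrite (eq_cvg _ _ integral_K) in cb.
have cb' : (\int[mu]_(x in K n) (f (1 + b) x)%:E +
    (F n.+2%:R - F n.+2%:R^-1)%:E @[n --> \oo] -->
    \int[mu]_(x in `]0%R, +oo[) (f (1 + b) x)%:E + 0%:E)%E.
  apply: cvgeD => //; first by rewrite fin_num_adde_defl.
  by apply: cvg_EFin cvg_F; exact: nearW.
by have := cvg_unique _ cb cb'; rewrite adde0; exact.
Qed.

Let gamma_fin : (\int[mu]_(x in `]0%R, +oo[) (f (1 + b) x)%:E < +oo)%E.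
Proof.
(* The exponential density of rate 1/2 is exp(- x / 2) / 2 for x >= 0, so the factor 4 reproduces
   the bound of [xb_le]. *)
apply: (@le_lt_trans _ _ (\int[mu]_x (4 * exponential_pdf 2^-1 x)%:E)%E).
  apply: (@le_trans _ _
    (\int[mu]_(x in `]0%R, +oo[) (4 * exponential_pdf 2^-1 x)%:E)%E).
    apply: ge0_le_integral => //.
    - by move=> *; rewrite lee_fin.
    - by apply/measurable_EFinP; exact: measurable_f.
    - apply/measurable_EFinP/measurable_funTS/measurable_funM => //.
      exact: measurable_exponential_pdf.
    - move=> x; rewrite /= in_itv/= andbT => /ltW x0.
      rewrite lee_fin exponential_pdfE// f1b//; apply: le_trans (xb_le x0) _.
      rewrite (_ : - x / 2 = - 2^-1 * x); last by rewrite mulNr mulrC mulNr.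
      by have := expR_ge0 (- 2^-1 * x); lra.
  apply: ge0_subset_integral => //.
  - apply/measurable_EFinP/measurable_funM => //.
    exact: measurable_exponential_pdf.
  - by move=> *; rewrite lee_fin mulr_ge0// exponential_pdf_ge0.
under eq_integral do rewrite EFinM.
rewrite integralZl ?integrable_exponential_pdf//.
by rewrite integral_exponential_pdf// mule1 ltry.
Qed.

(** The singularity at 0 needs no estimate of its own: an infinite integral would make the left side
    of [gamma_rec] infinite. *)
Let gamma_fin_b : (\int[mu]_(x in `]0%R, +oo[) (f b x)%:E < +oo)%E.
Proof.
have := gamma_fin; rewrite -gamma_rec !ltey; apply: contraNN => /eqP ->.
by rewrite gt0_muley.
Qed.

Let gamma_pos : (0 < \int[mu]_(x in `]0%R, +oo[) (f b x)%:E)%E.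
Proof.
(* Both factors of the integrand decrease, as b < 1, so on [1, 2] the value at 2 is a lower
   bound. *)
have ic : (\int[mu]_(x in `[1%R, 2%R]) (2 `^ (b - 1) * expR (- 2))%:E =
    (2 `^ (b - 1) * expR (- 2))%:E)%E.
  rewrite integral_cst// -[X in (_ * X)%E]/(lebesgue_measure _).
  rewrite lebesgue_measure_itv/= lte_fin ltr1n -EFinB.
  by rewrite (_ : 2 - 1 = 1 :> R) ?mule1//; lra.
apply: (@lt_le_trans _ _ (2 `^ (b - 1) * expR (- 2))%:E%E).
  by rewrite lte_fin mulr_gt0 ?powR_gt0 ?expR_gt0.
rewrite -ic; apply: (@le_trans _ _ (\int[mu]_(x in `[1%R, 2%R]) (f b x)%:E)%E).
  apply: ge0_le_integral => //.
  - by apply/measurable_EFinP; exact: measurable_f.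
  - move=> x; rewrite /= in_itv/= => /andP[x1 x2].
    rewrite lee_fin ler_pM ?powR_ge0 ?expR_ge0 ?ler_expR ?lerN2//.
    rewrite -opprB !powRN lef_pV2 ?posrE ?powR_gt0//; last first.
      exact: lt_le_trans x1.
    apply: ge0_ler_powR; rewrite ?nnegrE ?subr_ge0 ?(ltW b1)//.
    by rewrite (le_trans _ x1).
apply: ge0_subset_integral => //.
- by apply/measurable_EFinP; exact: measurable_f.
- by move=> *; rewrite lee_fin.
- by move=> x; rewrite /= !in_itv/= andbT => /andP[+ _]; apply: lt_le_trans.
Qed.

Lemma GammaE q : Gamma q = fine (\int[mu]_(x in `]0%R, +oo[) (f q x)%:E)%E.
Proof. by []. Qed.

Lemma Gamma1D : Gamma (1 + b) = b * Gamma b.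
Proof.
rewrite !GammaE -gamma_rec fineM// ge0_fin_numE ?gamma_fin_b//.
by apply: integral_ge0 => *; rewrite lee_fin.
Qed.

(** Finiteness matters here as much as positivity, since [fine] sends an infinite integral to 0. *)
Lemma Gamma_gt0 : 0 < Gamma b.
Proof. by rewrite GammaE fine_gt0// gamma_pos gamma_fin_b. Qed.

End gamma.

(** * L1 kernels *)

(** Monotonicity of r |-> r^a applied to d / x <= e / y, with the hypothesis cleared of
    denominators. *)
Lemma powRN_cross (R : realType) (a x y d e : R) :
  0 <= a -> 0 < x -> 0 < y -> 0 < d -> 0 < e ->
  d * y <= e * x -> x `^ (- a) * d `^ a <= y `^ (- a) * e `^ a.
Proof.
move=> a0 x0 y0 d0 e0 dyex; rewrite !powRN ler_pdivrMl ?powR_gt0// mulrCA.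
rewrite ler_pdivlMl ?powR_gt0//.
rewrite -!powRM ?(ltW x0) ?(ltW y0) ?(ltW d0) ?(ltW e0)//.
apply: ge0_ler_powR => //; last by rewrite mulrC (mulrC x).
- by rewrite nnegrE mulr_ge0// ltW.
- by rewrite nnegrE mulr_ge0// ltW.
Qed.

Section kernel.
Variables (R : realType) (alpha : R) (t : nat -> R) (N : nat).
Hypotheses (alpha_gt0 : 0 < alpha) (alpha_lt1 : alpha < 1).
Hypothesis t_incr : forall n : nat, (1 <= n <= N)%N -> t n.-1 < t n.
Notation mu := (@lebesgue_measure R).

Lemma mesh_le m n : (m <= n <= N)%N -> t m <= t n.
Proof.
move=> /andP[]; elim: n => [|n IH]; first by rewrite leqn0 => /eqP->.
rewrite leq_eqVlt => /predU1P[->//|mn nN].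
by rewrite (le_trans (IH mn (ltnW nN)))// ltW// (t_incr (n := n.+1)).
Qed.

Let a1_gt0 : 0 < 1 - alpha. Proof. by rewrite subr_gt0. Qed.
Let a1_lt1 : 1 - alpha < 1. Proof. by rewrite gtrBl. Qed.

(** The right endpoint, which is the singularity when k = n, is left out to match the interval of
    [integral_singular_powR]. *)
Let I n k := \int[mu]_(s in `[t k.-1, t k[) (t n - s) `^ (- alpha).

Let step_gt0 k : (1 <= k <= N)%N -> 0 < step t k.
Proof. by move=> /t_incr; rewrite /step subr_gt0. Qed.

Let integrable_kernel n k : (1 <= k <= n)%N -> (n <= N)%N ->
  mu.-integrable `[t k.-1, t k[ (EFin \o (fun s => (t n - s) `^ (- alpha))).
Proof.
move=> /andP[k1 kn] nN.
have tkn : t k <= t n by rewrite mesh_le// kn nN.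
have tk : t k.-1 < t k by rewrite t_incr// k1 (leq_trans kn).
rewrite (_ : - alpha = 1 - alpha - 1); last by ring.
have := integrable_singular_powR a1_gt0 (lt_le_trans tk tkn).
by apply: integrableS => //; apply: subset_itvl; rewrite bnd_simp.
Qed.

Let l1E n k : (1 <= k <= n)%N -> (n <= N)%N ->
  l1_kernel alpha t n k = I n k / (step t k * Gamma (1 - alpha)).
Proof.
move=> kn nN; rewrite /l1_kernel /omega.
have e : 1 - alpha - 1 = - alpha by ring.
rewrite e -Rintegral_itv_bndo_bndc; last first.
  by apply: integrable_EFinZr => //; exact: integrable_kernel.
rewrite RintegralZr//; last exact: integrable_kernel.
by rewrite mulrC invfM -mulrA; congr (_ * _); rewrite mulrC.
Qed.

Let G0 : 0 < Gamma (1 - alpha). Proof. exact: Gamma_gt0. Qed.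

Let I_gt0 n k : (1 <= k <= n)%N -> (n <= N)%N -> 0 < I n k.
Proof.
move=> kn nN; have /andP[k1 kn'] := kn.
have tkn : t k <= t n by rewrite mesh_le// kn' nN.
have tk : t k.-1 < t k by rewrite t_incr// k1 (leq_trans kn').
have tn : t k.-1 < t n := lt_le_trans tk tkn.
have d0 : 0 < t n - t k.-1 by rewrite subr_gt0.
have mc : fine (mu `[t k.-1, t k[%classic) = t k - t k.-1.
  by rewrite lebesgue_measure_itv/= lte_fin tk.
(* The integrand increases with s, so its value at the left endpoint bounds it from below. *)
apply: (@lt_le_trans _ _
  (\int[mu]_(s in `[t k.-1, t k[) ((t n - t k.-1) `^ (- alpha)))).
  by rewrite Rintegral_cst// mc mulr_gt0 ?powR_gt0// subr_gt0.
apply: le_Rintegral => //.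
- apply/integrableP; split; first exact: measurable_cst.
  rewrite integral_cst// -[X in (_ * X)%E]/(lebesgue_measure _).
  rewrite lebesgue_measure_itv/= lte_fin tk.
  by rewrite -EFinB -EFinM ltry.
- exact: integrable_kernel.
- move=> s; rewrite /= in_itv/= => /andP[s1 s2].
  rewrite !powRN lef_pV2 ?posrE ?powR_gt0 ?subr_gt0 ?tn ?(lt_le_trans s2)//.
  by apply: ge0_ler_powR;
    rewrite ?nnegrE ?subr_ge0 ?lerD2l ?lerN2 ?(ltW alpha_gt0)//;
    rewrite ltW// (lt_le_trans _ tkn).
Qed.

Lemma l1_kernel_gt0 n k : (1 <= k <= n)%N -> (n <= N)%N ->
  0 < l1_kernel alpha t n k.
Proof.
move=> kn nN; have /andP[k1 kn'] := kn.
rewrite l1E// divr_gt0 ?I_gt0// mulr_gt0 ?step_gt0//.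
by rewrite k1 (leq_trans kn').
Qed.

Lemma l1_kernel_le m n k : (1 <= k <= m)%N -> (m <= n <= N)%N ->
  l1_kernel alpha t n k <= l1_kernel alpha t m k.
Proof.
move=> /andP[k1 km] /andP[mn nN].
have mN := leq_trans mn nN; have kN := leq_trans km mN.
have tmn : t m <= t n by rewrite mesh_le// mn nN.
have tkm : t k <= t m by rewrite mesh_le// km mN.
rewrite !l1E ?k1 ?km ?(leq_trans km)//.
rewrite ler_pM2r ?invr_gt0 ?mulr_gt0 ?step_gt0 ?k1//.
apply: le_Rintegral => //.
- by apply: integrable_kernel => //; rewrite k1 (leq_trans km).
- by apply: integrable_kernel => //; rewrite k1.
- move=> s; rewrite /= in_itv/= => /andP[s1 s2].
  have sm : s < t m by exact: lt_le_trans tkm.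
  have sn : s < t n by exact: lt_le_trans tmn.
  rewrite !powRN lef_pV2 ?posrE ?powR_gt0 ?subr_gt0//.
  by apply: ge0_ler_powR; rewrite ?nnegrE ?subr_ge0 ?lerD2r// ltW.
Qed.

(* Both ratios of kernels are compared with ((t j - t k) / (t n - t k))^alpha,
   the value of the ratio of the integrands at the common node s = t k. *)
Lemma l1_kernel_cross j n k : (1 <= k < j)%N -> (j <= n <= N)%N ->
  l1_kernel alpha t j k * l1_kernel alpha t n k.+1 <=
  l1_kernel alpha t n k * l1_kernel alpha t j k.+1.
Proof.
move=> /andP[k1 kj] /andP[jn nN].
have jN := leq_trans jn nN; have kN := leq_trans (ltnW kj) jN.
have kn := leq_trans kj jn; have k1N := leq_trans kn nN.
have tjn : t j <= t n by rewrite mesh_le// jn nN.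
have tk : t k.-1 < t k by rewrite t_incr// k1.
have tk1 : t k < t k.+1 by have := t_incr (n := k.+1); rewrite /= k1N; apply.
have tk1j : t k.+1 <= t j by rewrite mesh_le// kj.
have dj : 0 < t j - t k by rewrite subr_gt0 (lt_le_trans tk1).
have dn : 0 < t n - t k by rewrite subr_gt0 (lt_le_trans tk1)// (le_trans tk1j).
rewrite !l1E ?k1 ?ltnS ?(ltnW kj) ?(ltnW kn)//.
rewrite mulrACA [leRHS]mulrACA ler_pM2r; last first.
  by rewrite mulr_gt0 ?invr_gt0 ?mulr_gt0 ?step_gt0// k1.
have ik m l : (1 <= l <= m)%N -> (m <= N)%N -> mu.-integrable `[t l.-1, t l[
    (EFin \o (fun s => (t m - s) `^ (- alpha) * (t m - t k) `^ alpha)).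
  by move=> lm mN; apply: integrable_EFinZr => //; exact: integrable_kernel.
have Imul m l : (1 <= l <= m)%N -> (m <= N)%N -> I m l * (t m - t k) `^ alpha =
    \int[mu]_(s in `[t l.-1, t l[)
      ((t m - s) `^ (- alpha) * (t m - t k) `^ alpha).
  by move=> lm mN; rewrite RintegralZr//; exact: integrable_kernel.
pose Qj := (t j - t k) `^ alpha; pose Qn := (t n - t k) `^ alpha.
have Q0 : 0 < Qj * Qn by rewrite mulr_gt0 ?powR_gt0.
(* For s <= t k the ratio (t j - t k) / (t j - s) is at most (t n - t k) / (t n - s), because t j <=
   t n; for s >= t k the inequality reverses, which gives [right_le]. *)
have left_le : I j k * Qj <= I n k * Qn.
  rewrite !Imul ?k1 ?(ltnW kj) ?(ltnW kn)//.
  apply: le_Rintegral => //.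
  - by apply: ik => //; rewrite k1 ltnW.
  - by apply: ik => //; rewrite k1 ltnW.
  - move=> s; rewrite /= in_itv/= => /andP[s1 s2].
    have sj : 0 < t j - s by rewrite subr_gt0 (lt_trans s2)// -subr_gt0.
    have sn : 0 < t n - s by rewrite subr_gt0 (lt_trans s2)// -subr_gt0.
    apply: powRN_cross => //; [exact: ltW|nra].
have right_le : I n k.+1 * Qn <= I j k.+1 * Qj.
  rewrite !Imul ?kj ?kn//.
  apply: le_Rintegral => //.
  - exact: ik.
  - exact: ik.
  - move=> s; rewrite /= in_itv/= => /andP[s1 s2].
    have sj : 0 < t j - s by rewrite subr_gt0 (lt_le_trans s2).
    have sn : 0 < t n - s.
      by rewrite subr_gt0 (lt_le_trans s2)// (le_trans tk1j).
    apply: powRN_cross => //; [exact: ltW|nra].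
rewrite -(ler_pM2r Q0) mulrACA [in leRHS](mulrC Qj) [leRHS]mulrACA.
apply: ler_pM => //; rewrite mulr_ge0 ?powR_ge0// ltW// I_gt0 ?kj ?kn//.
by rewrite k1 ltnW.
Qed.

(** The integral contributes 1 / (1 - alpha), which the recurrence Gamma (2 - alpha) = (1 - alpha)
    Gamma (1 - alpha) absorbs. *)
Lemma l1_kernel_diag n : (1 <= n <= N)%N ->
  l1_kernel alpha t n n = step t n `^ (- alpha) / Gamma (2 - alpha).
Proof.
move=> n1N; have /andP[n1 nN] := n1N; have tn := t_incr n1N.
have := integral_singular_powR a1_gt0 tn.
rewrite (_ : 1 - alpha - 1 = - alpha); last by ring.
move=> intE; rewrite l1E ?n1 ?leqnn//.
have -> : I n n = step t n `^ (1 - alpha) / (1 - alpha).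
  exact: (congr1 fine intE).
rewrite (_ : 2 - alpha = 1 + (1 - alpha)); last by ring.
rewrite (Gamma1D a1_gt0 a1_lt1).
have := step_gt0 n1N; move: (step t n) => s s0.
rewrite powRD ?gt_eqF ?implybT// powRr1 ?ltW//.
by field; rewrite !gt_eqF.
Qed.

End kernel.

(** * Discrete orthogonal convolution kernels *)

(** For k < n the DOC recursion is this identity solved for its term j = k. It says that the two
    triangular matrices are inverse to each other. *)
Lemma doc_orthogonal (R : realType) (alpha : R) (t : nat -> R) n k :
  (1 <= k <= n)%N -> l1_kernel alpha t k k != 0 ->
  \sum_(k <= j < n.+1) doc_kernel alpha t n j * l1_kernel alpha t j k =
  (k == n)%:R.
Proof.
move=> /andP[k1 kn] akk.
rewrite big_ltn//; move: kn; rewrite leq_eqVlt => /predU1P[<-|kn].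
  by rewrite big_geq// addr0 doc_kernel_diag mul1r mulVf// eqxx.
rewrite doc_kernel_rec; last first.
  by rewrite k1 -ltnS prednK// (leq_trans k1 (ltnW kn)).
by rewrite mulrAC mulNr mulVf// mulN1r addNr ltn_eqF.
Qed.

(** * Signs and row sums of the inverse of a triangular kernel matrix *)

Section orthogonal_kernel.
Variables (R : realFieldType) (N : nat) (a theta : nat -> nat -> R).
Hypothesis a_gt0 : forall n k, (1 <= k <= n)%N -> (n <= N)%N -> 0 < a n k.
Hypothesis a_le : forall m n k, (1 <= k <= m)%N -> (m <= n <= N)%N ->
  a n k <= a m k.
Hypothesis a_cross : forall j n k, (1 <= k < j)%N -> (j <= n <= N)%N ->
  a j k * a n k.+1 <= a n k * a j k.+1.
Hypothesis orthogonal : forall n k, (1 <= k <= n)%N -> (n <= N)%N ->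
  \sum_(k <= j < n.+1) theta n j * a j k = (k == n)%:R.

(* Eliminating theta n n between the orthogonality identities for k and k + 1
   leaves an expression of theta n k through the theta n j with k < j < n, with
   coefficients whose sign is given by the cross inequality. *)
Lemma orthogonal_le0 n k : (1 <= k < n)%N -> (n <= N)%N -> theta n k <= 0.
Proof.
(* Strong induction on n - k: entries closer to the diagonal come first. *)
move=> + nN; have [m] := ubnP (n - k); elim: m k => // m IH k nkm /andP[k1 kn].
have IHk j : (k < j < n)%N -> theta n j <= 0.
  move=> /andP[kj jn]; apply: IH; last by rewrite jn (leq_trans _ kj).
  by rewrite (leq_trans _ (_ : n - k <= m)%N) ?ltn_sub2l// -ltnS.
have kN : (k <= N)%N by rewrite ltnW// (leq_trans kn).
have ank1 : 0 < a n k.+1 by rewrite a_gt0.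
have akk : 0 < a k k by rewrite a_gt0// k1 leqnn.
have ank : 0 < a n k by rewrite a_gt0// k1 ltnW.
have := orthogonal (n := n) (k := k).
rewrite k1 ltnW// ltn_eqF// => /(_ isT nN).
rewrite big_ltn ?ltnS 1?ltnW// => Ek.
(* The sum is 1 if k + 1 = n and 0 otherwise; its sign suffices. *)
have Ek1 : 0 <= \sum_(k.+1 <= j < n.+1) theta n j * a j k.+1.
  by rewrite orthogonal ?ler0n// kn.
(* The coefficient vanishes at j = n; for j < n it is nonpositive, as is theta n j by induction. *)
have pos : 0 <= \sum_(k.+1 <= j < n.+1)
    theta n j * (a j k * a n k.+1 - a n k * a j k.+1).
  rewrite big_nat; apply: sumr_ge0 => j /andP[kj].
  rewrite ltnS leq_eqVlt => /predU1P[->|jn]; first by rewrite subrr mulr0.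
  rewrite mulr_le0 ?IHk ?kj// subr_le0 a_cross ?k1//.
  by rewrite ltnW.
rewrite -(pmulr_lle0 _ akk) -(pmulr_lle0 _ ank1).
move: pos.
under eq_bigr do rewrite mulrBr mulrA mulrCA.
rewrite sumrB -mulr_suml -mulr_sumr subr_ge0.
have -> : \sum_(k.+1 <= j < n.+1) theta n j * a j k = - (theta n k * a k k).
  by apply/eqP; rewrite -addr_eq0 addrC Ek.
rewrite mulNr => h; rewrite -oppr_ge0; apply: le_trans h.
by rewrite mulr_ge0// ltW.
Qed.

(** Multiply by a n 1 and compare with the orthogonality identity for k = 1: since theta n j <= 0
    and a n 1 <= a j 1 for j < n, replacing a j 1 by a n 1 can only increase the sum. *)
Lemma orthogonal_sum_ge0 n :
  (1 <= n <= N)%N -> 0 <= \sum_(1 <= j < n.+1) theta n j.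
Proof.
move=> /andP[n1 nN].
have an1 : 0 < a n 1%N by rewrite a_gt0.
rewrite -(pmulr_lge0 _ an1) mulr_suml.
have : 0 <= \sum_(1 <= j < n.+1) theta n j * a j 1%N.
  by rewrite orthogonal ?ler0n// n1.
move=> /le_trans; apply; apply: ler_sum_nat => j /andP[j1].
rewrite ltnS leq_eqVlt => /predU1P[->//|jn].
by apply: ler_wnM2l; rewrite ?orthogonal_le0 ?j1// a_le// ltnW.
Qed.

(** Weight the j-th equation by theta n j, sum over j and exchange the order of summation;
    orthogonality then isolates d n. *)
Lemma orthogonal_invert (d f : nat -> R) n : (1 <= n <= N)%N ->
  (forall j, (1 <= j <= n)%N -> \sum_(1 <= k < j.+1) a j k * d k = f j) ->
  d n = \sum_(1 <= j < n.+1) theta n j * f j.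
Proof.
move=> /andP[n1 nN] E.
(* The inner range is widened to n under the guard k <= j, so that the triangular sum can be
   exchanged. *)
rewrite (eq_big_nat _ _ (F2 := fun j =>
    \sum_(1 <= k < n.+1 | (k <= j)%N) theta n j * a j k * d k)); last first.
  move=> j /andP[j1 jn]; rewrite -E ?j1// mulr_sumr.
  rewrite (big_nat_widen _ _ n.+1)//; apply: eq_bigr => k _.
  by rewrite mulrA.
rewrite (exchange_big_dep_nat xpredT)//=.
rewrite (eq_big_nat _ _ (F2 := fun k => (k == n)%:R * d k)); last first.
  move=> k /andP[k1 kn]; rewrite -(orthogonal (n := n)) ?k1//.
  rewrite -mulr_suml; congr (_ * _).
  by rewrite [RHS](big_nat_widenl _ 1%N).
rewrite big_nat_recr//= eqxx mul1r big_nat big1 ?add0r// => k /andP[_ kn].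
by rewrite ltn_eqF// mul0r.
Qed.

End orthogonal_kernel.

(** * The quadratic form at one grid point *)

Section dissipation.
Variables (R : realFieldType) (n : nat) (kappa : R) (theta m : nat -> R).
Hypotheses (n_gt0 : (0 < n)%N) (kappa_gt0 : 0 < kappa).
Hypothesis theta_le0 : forall j, (1 <= j < n)%N -> theta j <= 0.
Hypothesis sum_theta : 0 <= \sum_(1 <= j < n.+1) theta j.
Hypothesis theta_n : kappa * theta n <= 1.

(* Expand - \sum_(j < n) theta j (y - m j)^2 >= 0 at y = m n - kappa W, where
   W = \sum_j theta j m j. *)
Lemma dissipation (d := - kappa * \sum_(1 <= j < n.+1) theta j * m j) :
  m n * d + d ^+ 2 / 2 +
    kappa / 2 * \sum_(1 <= j < n.+1) theta j * m j ^+ 2 <= 0.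
Proof.
rewrite {}/d; set W := \sum_(_ <= _ < _) _.
set Z := \sum_(_ <= _ < _) _ * _ ^+ 2.
pose S := \sum_(1 <= j < n.+1) theta j.
pose y := m n - kappa * W.
have : \sum_(1 <= j < n) theta j * (y - m j) ^+ 2 <= 0.
  rewrite big_nat; apply: sumr_le0 => j jn.
  by rewrite mulr_le0_ge0 ?theta_le0 ?sqr_ge0.
(* The full sum up to n expands into the first three terms; the last one removes j = n, where y - m
   n = - kappa W. *)
have -> : \sum_(1 <= j < n) theta j * (y - m j) ^+ 2 =
    S * y ^+ 2 - 2 * y * W + Z - theta n * (kappa * W) ^+ 2.
  transitivity (\sum_(1 <= j < n.+1) theta j * (y - m j) ^+ 2 -
      theta n * (y - m n) ^+ 2); first by rewrite big_nat_recr//= addrK.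
  congr (_ - _); last by rewrite /y; ring.
  rewrite /S /W /Z mulr_suml mulr_sumr -sumrB -big_split/=.
  by apply: eq_bigr => j _; ring.
have Sy : 0 <= S * y ^+ 2 by rewrite mulr_ge0// sqr_ge0.
(* The step size condition enters here, through kappa theta_n <= 1. *)
have kW : 0 <= (1 - kappa * theta n) * (kappa * W ^+ 2).
  by rewrite mulr_ge0 ?subr_ge0// mulr_ge0 ?sqr_ge0// ltW.
move=> h.
have : 0 <= 2 * y * W - Z + theta n * (kappa * W) ^+ 2 by lra.
rewrite /y => h2.
(* Multiplied by - kappa / 2, the right side is the left side of the goal. *)
have h3 : 0 <= 2 * m n * W - Z - kappa * W ^+ 2 by nra.
have := mulr_ge0 (ltW kappa_gt0) h3; nra.
Qed.

End dissipation.

(** * Energy *)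

Section grid_sum.
Variables (R : realType) (M : nat) (h : R).
Implicit Types v w : gridfun R.

Lemma inner_ge0 v : 0 <= inner M h v v.
Proof.
rewrite /inner mulr_ge0 ?sqr_ge0// sumr_ge0// => i _.
by rewrite sumr_ge0// => j _; rewrite -expr2 sqr_ge0.
Qed.

Lemma norm2_sqr v : norm2 M h v ^+ 2 = inner M h v v.
Proof. by rewrite sqr_sqrtr ?inner_ge0. Qed.

Lemma vnorm2_sqr V : vnorm2 M h V ^+ 2 = vinner M h V V.
Proof. by rewrite sqr_sqrtr// addr_ge0 ?inner_ge0. Qed.

(** Writing all norms and inner products through one monotone linear functional reduces the energy
    estimates to inequalities at each grid point. *)
Definition grid_sum v : R :=
  h ^+ 2 * \sum_(1 <= i < M.+1) \sum_(1 <= j < M.+1) v i%:Z j%:Z.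

Lemma innerE v w : inner M h v w = grid_sum (fun i j => v i j * w i j).
Proof. by []. Qed.

Lemma grid_sumD v w :
  grid_sum v + grid_sum w = grid_sum (fun i j => v i j + w i j).
Proof.
rewrite /grid_sum -mulrDr -big_split; congr (_ * _).
by apply: eq_bigr => i _; rewrite -big_split.
Qed.

Lemma grid_sumZ c v : c * grid_sum v = grid_sum (fun i j => c * v i j).
Proof.
rewrite /grid_sum mulrCA mulr_sumr; congr (_ * _).
by apply: eq_bigr => i _; rewrite mulr_sumr.
Qed.

Lemma grid_sumB v w :
  grid_sum v - grid_sum w = grid_sum (fun i j => v i j - w i j).
Proof.
rewrite /grid_sum -mulrBr -sumrB; congr (_ * _).
by apply: eq_bigr => i _; rewrite -sumrB.
Qed.

Lemma grid_sum_sum n (u : nat -> gridfun R) :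
  \sum_(1 <= k < n) grid_sum (u k) =
  grid_sum (fun i j => \sum_(1 <= k < n) u k i j).
Proof.
rewrite /grid_sum -mulr_sumr exchange_big; congr (_ * _).
by apply: eq_bigr => i _; rewrite exchange_big.
Qed.

Lemma grid_sum_le v w :
  (forall i j, v i j <= w i j) -> grid_sum v <= grid_sum w.
Proof.
by move=> vw; rewrite ler_wpM2l ?sqr_ge0// ler_sum// => i _; rewrite ler_sum.
Qed.

Lemma eq_grid_sum v w : (forall i j, v i j = w i j) -> grid_sum v = grid_sum w.
Proof. by move=> vw; congr (_ * _); do 2 (apply: eq_bigr => ? _). Qed.

(* Convexity of the quartic and gradient parts, and exactness of the expansion
   of the concave part, of the energy. *)
Lemma energy_sub_le eps v w :
  grid_periodic M v -> grid_periodic M w ->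
  energy M h eps v - energy M h eps w <=
  grid_sum (fun i j => chem_pot h eps v i j * (v i j - w i j) +
                       (v i j - w i j) ^+ 2 / 2).
Proof.
move=> pv pw; pose d : gridfun R := fun i j => v i j - w i j.
have pd : grid_periodic M d.
  by move=> i j; rewrite /d !(pv i j).1 !(pw i j).1 !(pv i j).2 !(pw i j).2.
(* By Green's formula the right side is twice the inner product of the gradients of v and d; the gap
   is the squared norm of the gradient of d. *)
have grad : vinner M h (gradient h v) (gradient h v) -
    vinner M h (gradient h w) (gradient h w) <=
    2 * inner M h (fun i j => - laplacian h v i j) d.
  rewrite green// /vinner !innerE !grid_sumD grid_sumB grid_sumZ.
  apply: grid_sum_le => i j; rewrite /gradient /d/=.
  move: (h^-1) (v (i + 1) j) (v i (j + 1)) (w (i + 1) j) (w i (j + 1)).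
  move: (v i j) (w i j) => v0 w0 k v1 v2 w1 w2.
  rewrite -subr_ge0 [leRHS](_ : _ = ((v1 - w1 - (v0 - w0)) * k) ^+ 2 +
    ((v2 - w2 - (v0 - w0)) * k) ^+ 2); first by rewrite addr_ge0 ?sqr_ge0.
  by ring.
rewrite /energy !vnorm2_sqr !norm2_sqr.
have pot :
    1 / 4 * inner M h (fun i j => v i j ^+ 2 - 1) (fun i j => v i j ^+ 2 - 1) -
    1 / 4 * inner M h (fun i j => w i j ^+ 2 - 1) (fun i j => w i j ^+ 2 - 1) <=
    grid_sum (fun i j => (v i j ^+ 3 - v i j) * d i j + d i j ^+ 2 / 2).
  rewrite !innerE !grid_sumZ grid_sumB.
  apply: grid_sum_le => i j; rewrite /d; move: (v i j) (w i j) => x y.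
  (* The quadratic terms cancel. What is left, (3 x^4 - 4 x^3 y + y^4) / 4, is the convexity gap of
     u^4 / 4, written as a sum of squares. *)
  rewrite -subr_ge0 [leRHS](_ : _ = ((x ^+ 2 - y ^+ 2) ^+ 2 +
    2 * (x * (x - y)) ^+ 2) / 4); last by field.
  apply: divr_ge0 => //; apply: addr_ge0; first exact: sqr_ge0.
  by apply: mulr_ge0 => //; exact: sqr_ge0.
have -> : grid_sum (fun i j => chem_pot h eps v i j * (v i j - w i j) +
                       (v i j - w i j) ^+ 2 / 2) =
  grid_sum (fun i j => (v i j ^+ 3 - v i j) * d i j + d i j ^+ 2 / 2) +
  eps ^+ 2 / 2 * (2 * inner M h (fun i j => - laplacian h v i j) d).
  rewrite innerE !grid_sumZ grid_sumD; apply: eq_grid_sum => i j.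
  rewrite /chem_pot /d; move: (laplacian h v i j) (v i j) (w i j) => l x y.
  by field.
have e0 : 0 <= eps ^+ 2 / 2 by rewrite divr_ge0 ?sqr_ge0.
have := lerD (ler_wpM2l e0 grad) pot; rewrite mulrBr addrACA -opprD.
by rewrite [leRHS]addrC.
Qed.

End grid_sum.

(** * The discrete energy law *)

Theorem theorem2p2 (R : realType) (L : R) (M : nat) (h : R)
    (alpha kappa eps T : R) (N : nat) (t : nat -> R)
    (Phi0 : R -> R -> R) (phi : nat -> gridfun R)
    (L_gt0 : 0 < L) (M_gt0 : (0 < M)%N) (hE : h = L / M%:R)
    (alpha_gt0 : 0 < alpha) (alpha_lt1 : alpha < 1)
    (kappa_gt0 : 0 < kappa) (eps_gt0 : 0 < eps)
    (t0 : t 0%N = 0) (tN : t N = T)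
    (t_incr : forall n : nat, (1 <= n <= N)%N -> t n.-1 < t n)
    (step_le : forall n : nat, (1 <= n <= N)%N ->
       step t n <= 1 / (kappa * Gamma (2%:R - alpha)) `^ (alpha^-1))
    (Phi0_periodic : forall x y : R,
       Phi0 (x + L) y = Phi0 x y /\ Phi0 x (y + L) = Phi0 x y)
    (phi_periodic : forall n : nat, (n <= N)%N -> grid_periodic M (phi n))
    (phi_init : forall i j : int, phi 0%N i j = Phi0 (i%:~R * h) (j%:~R * h))
    (scheme : forall n : nat, (1 <= n <= N)%N -> forall i j : int,
       \sum_(1 <= k < n.+1) l1_kernel alpha t n k * (phi k i j - phi k.-1 i j)
       = - kappa * chem_pot h eps (phi n) i j) :
  forall n : nat, (1 <= n <= N)%N ->
    diff_quot t (var_energy alpha t M h eps kappa phi) n <= 0.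
Proof.
pose a := l1_kernel alpha t; pose theta := doc_kernel alpha t.
have a_gt0 := l1_kernel_gt0 alpha_gt0 alpha_lt1 t_incr.
have a_le := l1_kernel_le alpha_gt0 alpha_lt1 t_incr.
have a_cross := l1_kernel_cross alpha_gt0 alpha_lt1 t_incr.
have orth n k : (1 <= k <= n)%N -> (n <= N)%N ->
    \sum_(k <= j < n.+1) theta n j * a j k = (k == n)%:R.
  move=> kn nN; apply: doc_orthogonal => //; rewrite gt_eqF// a_gt0//.
    by case/andP: kn => -> _; rewrite leqnn.
  by case/andP: kn => _ /leq_trans; apply.
move=> n nN; have /andP[n1 nN'] := nN.
have taun : 0 < step t n by rewrite subr_gt0 t_incr.
(* Raised to the power alpha, the step size condition reads tau_n^alpha <= 1 / (kappa Gamma (2 -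
   alpha)). *)
have kappa_a : kappa <= a n n.
  have G0 : 0 < Gamma (2 - alpha).
    have a1_gt0 : 0 < 1 - alpha by rewrite subr_gt0.
    have a1_lt1 : 1 - alpha < 1 by rewrite gtrBl.
    rewrite (_ : 2 - alpha = 1 + (1 - alpha)); last by ring.
    by rewrite Gamma1D// mulr_gt0// Gamma_gt0.
  rewrite /a (l1_kernel_diag alpha_gt0 alpha_lt1 t_incr)// ler_pdivlMr//.
  have kG : 0 < kappa * Gamma (2 - alpha) by rewrite mulr_gt0.
  rewrite powRN -[leLHS]invrK lef_pV2 ?posrE ?invr_gt0 ?powR_gt0//.
  have := step_le n nN; rewrite div1r => h'.
  have : step t n `^ alpha <=
      ((kappa * Gamma (2 - alpha)) `^ alpha^-1)^-1 `^ alpha.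
    apply: ge0_ler_powR; rewrite ?nnegrE ?invr_ge0 ?powR_ge0//; exact: ltW.
  by rewrite -powRN -powRrM mulNr mulVf ?gt_eqF// powR_inv1// ltW.
have kappa_theta : kappa * theta n n <= 1.
  by rewrite /theta doc_kernel_diag div1r ler_pdivrMr ?mul1r// a_gt0// n1 leqnn.
have incr i j : phi n i j - phi n.-1 i j =
    - kappa * \sum_(1 <= k < n.+1) theta n k * chem_pot h eps (phi k) i j.
  rewrite (orthogonal_invert orth (d := fun k => phi k i j - phi k.-1 i j)
    (f := fun k => - kappa * chem_pot h eps (phi k) i j))//.
    by rewrite mulr_sumr; apply: eq_bigr => k _; rewrite mulrCA.
  by move=> k /andP[k1 kn]; rewrite -scheme// k1 (leq_trans kn).
(* At m = 0 the memory sum is empty, so one formula covers n - 1 = 0 as well. *)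
have venergyE m : (m <= N)%N -> var_energy alpha t M h eps kappa phi m =
    energy M h eps (phi m) + kappa / 2 * \sum_(1 <= j < m.+1)
      dcc_kernel alpha t m j * norm2 M h (chem_pot h eps (phi j)) ^+ 2.
  by case: m => // _; rewrite big_geq// mulr0 addr0.
rewrite /diff_quot ler_pdivrMr// mul0r.
rewrite !venergyE ?(leq_trans (leq_pred _))// prednK//.
(* Passing from n - 1 to n adds exactly theta n j to the DCC kernel of index j; the new index j = n
   carries theta n n alone. *)
have dccE : \sum_(1 <= j < n.+1)
      dcc_kernel alpha t n j * norm2 M h (chem_pot h eps (phi j)) ^+ 2 =
    \sum_(1 <= j < n)
      dcc_kernel alpha t n.-1 j * norm2 M h (chem_pot h eps (phi j)) ^+ 2 +
    \sum_(1 <= j < n.+1)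
      theta n j * norm2 M h (chem_pot h eps (phi j)) ^+ 2.
  rewrite !(big_nat_recr n)//= addrA -big_split/=; congr (_ + _).
    apply: eq_big_nat => j /andP[j1 jn]; rewrite -mulrDl; congr (_ * _).
    by rewrite /dcc_kernel big_nat_recr 1?ltnW//= prednK.
  by rewrite /dcc_kernel big_nat1.
rewrite dccE mulrDr.
have le1 := energy_sub_le h eps (phi_periodic n nN')
  (phi_periodic n.-1 (leq_trans (leq_pred _) nN')).
suff : grid_sum M h (fun i j =>
      chem_pot h eps (phi n) i j * (phi n i j - phi n.-1 i j) +
      (phi n i j - phi n.-1 i j) ^+ 2 / 2) +
    kappa / 2 * \sum_(1 <= j < n.+1)
      theta n j * norm2 M h (chem_pot h eps (phi j)) ^+ 2 <= 0.
  move: le1; lra.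
(* The memory term also becomes a grid sum, so that [dissipation] can be applied point by point with
   m k the value of mu^k there. *)
rewrite (eq_bigr (fun k => grid_sum M h (fun i j =>
  theta n k * chem_pot h eps (phi k) i j ^+ 2))); last first.
  by move=> k _; rewrite norm2_sqr innerE grid_sumZ; apply: eq_grid_sum.
rewrite grid_sum_sum grid_sumZ grid_sumD.
rewrite [leRHS](_ : 0 = grid_sum M h (fun _ _ => 0)); last first.
  by rewrite /grid_sum big1 ?mulr0// => k _; rewrite big1.
apply: grid_sum_le => i j; rewrite incr.
apply: dissipation => //.
- by move=> k kn; apply: (orthogonal_le0 a_gt0 a_cross orth).
- exact: (orthogonal_sum_ge0 a_gt0 a_le a_cross orth).
Qed.
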